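(* Let $f^n=(f^n_{l,m})$, $0\le l\le N_x-1$, $0\le m\le N_v-1$, be a discrete distribution function on a uniform phase-space grid of size $N_x\times N_v$ at a fixed time step $n$, where $l$ and $m$ are the spatial and velocity indices. Let $M_v>N_v$, and let $f^{ext,n}=(f^{ext,n}_{l,m_{ext}})$, $0\le l\le N_x-1$, $0\le m_{ext}\le M_v-1$, be the refined distribution function on the finer grid of size $N_x\times M_v$ obtained by zero-padding the high-wavenumber Fourier modes of $f^n$ along the velocity direction for each fixed spatial index $l$. Then this one-dimensional refinement operation exactly preserves the total discrete mass and the global discrete $L^2$-norm over the entire phase space: $$\mathrm{Mass}(f^{ext,n})=\mathrm{Mass}(f^n),\qquad \|f^{ext,n}\|_2=\|f^n\|_2 .$$ The same exact preservation holds for the analogous zero-padding refinement along the spatial direction, from the grid of size $N_x\times N_v$ to a grid of size $M_x\times N_v$ with $M_x>N_x$.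
   Context: Phase space is $[0,L_x]\times[-v_{\max},v_{\max}]$ with $L_x,v_{\max}>0$, $L_v=2v_{\max}$. The numbers of grid points in each direction ($N_x$, $N_v$, and the refined numbers $M_x$, $M_v$) are positive even integers. The uniform grid of size $N_x\times N_v$ consists of the points $(x_l,v_m)$, where $x_l=l\,\Delta x$ for $l=0,\dots,N_x-1$ with $\Delta x=L_x/N_x$, and $v_m=-v_{\max}+m\,\Delta v$ for $m=0,\dots,N_v-1$ with $\Delta v=L_v/N_v$. Refined grids cover the same domain and are defined in the same way with $N_v$ replaced by $M_v$ (mesh size $L_v/M_v$ in velocity), or $N_x$ replaced by $M_x$ (mesh size $L_x/M_x$ in space). A discrete distribution function is an array of values on the grid; no sign condition is imposed. Discrete Fourier transform in $v$, for each fixed $l$, with $\beta_{k}=2\pi k/L_v$: $$\hat f_{l,k_v}=\frac1{N_v}\sum_{m=0}^{N_v-1}f_{l,m}e^{-i\beta_{k_v}v_m},\qquad f_{l,m}=\sum_{k_v=-N_v/2}^{N_v/2-1}\hat f_{l,k_v}e^{i\beta_{k_v}v_m}.$$ On the refined grid the same formulas are used with $M_v$ and the refined velocity points in place of $N_v$ and $v_m$. In $x$, for each fixed $m$, with $\alpha_k=2\pi k/L_x$: $$\hat f_{k_x,m}=\frac1{N_x}\sum_{l=0}^{N_x-1}f_{l,m}e^{-i\alpha_{k_x}x_l},\qquad f_{l,m}=\sum_{k_x=-N_x/2}^{N_x/2-1}\hat f_{k_x,m}e^{i\alpha_{k_x}x_l}.$$ Zero-padding along $v$: $f^{ext,n}$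 is the array on the $N_x\times M_v$ grid whose Fourier coefficients in $v$ (for $-M_v/2\le k_v\le M_v/2-1$) are $$\hat f^{ext,n}_{l,k_v}=\begin{cases}\hat f^n_{l,k_v}, & -N_v/2\le k_v\le N_v/2-1,\\ 0,&\text{otherwise.}\end{cases}$$ (The values of $f^{ext,n}$ are allowed to be complex.) Zero-padding along $x$ is defined analogously, using the Fourier coefficients in $x$ for each fixed $m$. Discrete mass and $L^2$-norm of an array $g$ on a uniform grid with mesh sizes $\Delta x,\Delta v$ (those of the grid on which $g$ lives): $$\mathrm{Mass}(g)=\Delta x\,\Delta v\sum_{l,m}g_{l,m},\qquad \|g\|_2=\Big(\Delta x\,\Delta v\sum_{l,m}|g_{l,m}|^2\Big)^{1/2}.$$ *)

(* Defs.v *)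
From mathcomp Require Export all_boot all_order all_algebra.
From mathcomp Require Export complex.
From mathcomp Require Export reals trigo.
From mathcomp Require Import ring lra zify.

Set Implicit Arguments.
Unset Strict Implicit.
Unset Printing Implicit Defensive.

Import Order.TTheory GRing.Theory Num.Theory.
Local Open Scope ring_scope.
Local Open Scope complex_scope.

Definition expi (R : realType) (t : R) : R[i] := cos t +i* sin t.

(* Node j of the uniform n-point grid on the periodic interval [a, a + L[. *)
Definition grid_point (R : realType) (a L : R) (n j : nat) : R :=
  a + j%:R * (L / n%:R).

Definition wavenumber (R : realType) (L : R) (k : int) : R :=
  2 * pi * k%:~R / L.

Definition fourier_coef (R : realType) (a L : R) (n : nat)
    (u : 'I_n -> R[i]) (k : int) : R[i] :=
  (n%:R)^-1 *
  \sum_(j < n) u j * expi (- (wavenumber L k * grid_point a L n j)).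

(* The modes -n/2, ..., n/2 - 1 resolved by an n-point grid; n./2 is the exact
   half only for even n. *)
Definition resolved (n : nat) (k : int) : bool :=
  - (n./2)%:Z <= k <= (n./2)%:Z - 1.

(* Phase space is [0, Lx] x [- vmax, vmax]; an array on the p x q grid is a
   p x q matrix, with rows indexed by space and columns by velocity. *)
Definition fourier_v (R : realType) (vmax : R) (p q : nat)
    (g : 'M[R[i]]_(p, q)) (l : 'I_p) (kv : int) : R[i] :=
  fourier_coef (- vmax) (2 * vmax) (fun m => g l m) kv.

Definition fourier_x (R : realType) (Lx : R) (p q : nat)
    (g : 'M[R[i]]_(p, q)) (kx : int) (m : 'I_q) : R[i] :=
  fourier_coef 0 Lx (fun l => g l m) kx.

Definition zero_padding_v (R : realType) (vmax : R) (Nx Nv Mv : nat)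
    (f : 'M[R[i]]_(Nx, Nv)) (fext : 'M[R[i]]_(Nx, Mv)) : Prop :=
  forall (l : 'I_Nx) (kv : int), resolved Mv kv ->
    fourier_v vmax fext l kv =
    if resolved Nv kv then fourier_v vmax f l kv else 0.

Definition zero_padding_x (R : realType) (Lx : R) (Nx Nv Mx : nat)
    (f : 'M[R[i]]_(Nx, Nv)) (fext : 'M[R[i]]_(Mx, Nv)) : Prop :=
  forall (kx : int) (m : 'I_Nv), resolved Mx kx ->
    fourier_x Lx fext kx m =
    if resolved Nx kx then fourier_x Lx f kx m else 0.

(* Delta x * Delta v for the p x q grid. *)
Definition cell_area (R : realType) (Lx vmax : R) (p q : nat) : R :=
  (Lx / p%:R) * (2 * vmax / q%:R).

Definition mass (R : realType) (Lx vmax : R) (p q : nat)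
    (g : 'M[R[i]]_(p, q)) : R[i] :=
  (cell_area Lx vmax p q)%:C * \sum_(l < p) \sum_(m < q) g l m.

(* [normc] is the real-valued modulus; the generic norm on [R[i]] takes its
   values in [R[i]]. *)
Definition l2norm (R : realType) (Lx vmax : R) (p q : nat)
    (g : 'M[R[i]]_(p, q)) : R :=
  Num.sqrt (cell_area Lx vmax p q *
    \sum_(l < p) \sum_(m < q) ComplexField.Normc.normc (g l m) ^+ 2).

(* The padding relations are satisfiable: on an even grid, any prescribed
   coefficients of the resolved modes are attained. *)
Section Existence.
Variable R : realType.
Implicit Types (s t : R).

Lemma expiD s t : expi (s + t) = expi s * expi t.
Proof.
rewrite /expi cosD sinD; apply/eqP; rewrite eq_complex /=.
by rewrite eqxx /= addrC [cos s * _]mulrC [sin s * _]mulrC addrC [cos t * _]mulrC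
  [sin t * _]mulrC eqxx.
Qed.

Lemma expi0 : expi (0 : R) = 1.
Proof. by rewrite /expi cos0 sin0. Qed.

Lemma expiMn t n : expi (n%:R * t) = expi t ^+ n.
Proof.
elim: n => [|n IH]; first by rewrite mul0r expi0.
by rewrite -addn1 natrD mulrDl mul1r expiD IH exprD expr1.
Qed.

Lemma expi_2pi_int (k : int) : expi (2 * pi * k%:~R : R) = 1.
Proof.
have e2 : expi (2 * pi : R) = 1 by rewrite /expi mulr_natl cos2pi sin2pi.
have H n : expi (2 * pi * n%:R : R) = 1 by rewrite mulrC expiMn e2 expr1n.
case: k => n; first exact: H.
rewrite NegzE mulrNz mulrN; set t := _ * _.
have : expi (- t) * expi t = 1 by rewrite -expiD addNr expi0.
by rewrite /t H mulr1.
Qed.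

Lemma expi_neq1 t : 0 < t < 2 * pi -> expi t != 1.
Proof.
move=> /andP[t0 t1]; apply/eqP => /(congr1 (@complex.Re R)) /= ct.
have sp : 0 < sin (t / 2).
  by apply: sin_gt0_pi; rewrite ?in_itv /= divr_gt0 // ltr_pdivrMr // mulrC.
have cs := cos2Dsin2 (t / 2).
have : cos (t / 2 + t / 2) = 1 by rewrite -splitr.
rewrite cosD; nra.
Qed.

Lemma expi_root_neq1 (n : nat) (d : int) :
  (0 < n)%N -> d != 0 -> `|d| < n%:Z -> expi (2 * pi * d%:~R / n%:R : R) != 1.
Proof.
move=> n0 d0 dn; have n0R : (0 : R) < n%:R by rewrite ltr0n.
have pos (e : int) : 0 < e -> e < n%:Z -> expi (2 * pi * e%:~R / n%:R : R) != 1.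
  move=> e0 en; apply: expi_neq1; have p0 := pi_gt0 R.
  rewrite divr_gt0 ?mulr_gt0 ?ltr0z //= ltr_pdivrMr // ltr_pM2l ?mulr_gt0 //.
  by rewrite (_ : n%:R = n%:Z%:~R) // ltr_int.
have [dp|dp] := ltP 0 d; first by apply: pos => //; apply: le_lt_trans dn; exact: ler_norm.
have dneg : d < 0 by rewrite lt_neqAle d0.
have hN := pos (- d); rewrite oppr_gt0 dneg in hN.
have /hN : - d < n%:Z by rewrite -ltr0_norm.
move=> /(_ isT); apply: contraNN => /eqP h.
have : expi (2 * pi * (- d)%:~R / n%:R : R) * expi (2 * pi * d%:~R / n%:R) = 1.
  by rewrite -expiD -mulrDl -mulrDr -intrD addNr mulr0 mul0r expi0.
by rewrite h mulr1 => ->.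
Qed.

Lemma sum_expi (a L : R) (n : nat) (d : int) :
    L != 0 -> (0 < n)%N -> `|d| < n%:Z ->
  \sum_(j < n) expi (wavenumber L d * grid_point a L n j)
    = if d == 0 then n%:R else 0.
Proof.
move=> L0 n0 dn; have n0R : n%:R != 0 :> R by rewrite pnatr_eq0 -lt0n.
have [->|d0] := eqVneq d 0.
  under eq_bigr => j _ do rewrite /wavenumber mulr0 mul0r mul0r expi0.
  by rewrite sumr_const card_ord.
pose w : R[i] := expi (2 * pi * d%:~R / n%:R : R).
under eq_bigr => j _.
  rewrite /grid_point mulrDr expiD.
  rewrite (_ : wavenumber L d * (_ * _) = j%:R * (2 * pi * d%:~R / n%:R)).
    rewrite expiMn -/w; over.
  by rewrite /wavenumber; field; rewrite n0R.
rewrite -mulr_sumr.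
have w1 : w - 1 != 0 by rewrite subr_eq0; exact: expi_root_neq1.
have wn : w ^+ n = 1.
  by rewrite -expiMn mulrCA divff // mulr1 expi_2pi_int.
have := subrX1 w n; rewrite wn subrr => /esym/eqP.
by rewrite mulf_eq0 (negbTE w1) /= => /eqP ->; rewrite mulr0.
Qed.

Lemma fourier_coef_surj (a L : R) (n : nat) (c : int -> R[i]) :
    L != 0 -> (0 < n)%N -> ~~ odd n ->
  exists u : 'I_n -> R[i], forall k, resolved n k -> fourier_coef a L u k = c k.
Proof.
move=> L0 n0 nev.
have nE : n%:Z = (n./2)%:Z + (n./2)%:Z.
  by rewrite -PoszD addnn -[in LHS](odd_double_half n) (negbTE nev).
pose K (i : 'I_n) : int := (i : nat)%:Z - (n./2)%:Z.
exists (fun j => \sum_(i < n) c (K i) *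
  expi (wavenumber L (K i) * grid_point a L n j)) => k /andP[k1 k2].
have kn : (`|(k + (n./2)%:Z)%R| < n)%N.
  lia.
pose i0 := Ordinal kn.
have Ki0 : K i0 = k.
  rewrite /K /=; lia.
rewrite /fourier_coef.
under eq_bigr => j _ do rewrite mulr_suml.
rewrite exchange_big /=.
have E (i : 'I_n) : \sum_(j < n) c (K i) *
    expi (wavenumber L (K i) * grid_point a L n j) *
    expi (- (wavenumber L k * grid_point a L n j))
  = c (K i) * (if i == i0 then n%:R else 0).
  under eq_bigr => j _.
    rewrite -mulrA -expiD -mulrBl /wavenumber -mulrBl -mulrBr -intrB.
    rewrite -/(wavenumber L (K i - k)); over.
  rewrite -mulr_sumr sum_expi //.
    congr (_ * _); congr (if _ then _ else _).
    by rewrite subr_eq0 -[k in LHS]Ki0 /K (can_eq (subrK _)) eqz_nat.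
  have := ltn_ord i; rewrite /K; lia.
under eq_bigr => i _ do rewrite E.
rewrite (bigD1 i0) //= eqxx big1 ?addr0; last first.
  by move=> i /negbTE ->; rewrite mulr0.
by rewrite Ki0 mulrCA mulVf ?mulr1 // pnatr_eq0 -lt0n.
Qed.

Lemma zero_padding_v_exists (vmax : R) (Nx Nv Mv : nat)
    (f : 'M[R[i]]_(Nx, Nv)) :
    0 < vmax -> (0 < Mv)%N -> ~~ odd Mv ->
  exists fext : 'M[R[i]]_(Nx, Mv), zero_padding_v vmax f fext.
Proof.
move=> v0 M0 Mev; have L0 : 2 * vmax != 0 by rewrite mulf_neq0 // gt_eqF.
have /fin_all_exists[u uP] (l : 'I_Nx) := fourier_coef_surj (- vmax)
  (fun k => if resolved Nv k then fourier_v vmax f l k else 0) L0 M0 Mev.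
exists (\matrix_(l, m) u l m) => l k kM; rewrite -(uP l k kM).
by rewrite /fourier_v /fourier_coef; under eq_bigr do rewrite mxE.
Qed.

Lemma zero_padding_x_exists (Lx : R) (Nx Nv Mx : nat)
    (f : 'M[R[i]]_(Nx, Nv)) :
    0 < Lx -> (0 < Mx)%N -> ~~ odd Mx ->
  exists fext : 'M[R[i]]_(Mx, Nv), zero_padding_x Lx f fext.
Proof.
move=> L0 M0 Mev; have {}L0 : Lx != 0 by rewrite gt_eqF.
have /fin_all_exists[u uP] (m : 'I_Nv) := fourier_coef_surj 0
  (fun k => if resolved Nx k then fourier_x Lx f k m else 0) L0 M0 Mev.
exists (\matrix_(l, m) u m l) => k m kM; rewrite -(uP m k kM).
by rewrite /fourier_x /fourier_coef; under eq_bigr do rewrite mxE.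
Qed.

End Existence.

(* Main.v *)
Require Import Defs.
From mathcomp Require Import ring zify.

Set Implicit Arguments.
Unset Strict Implicit.
Unset Printing Implicit Defensive.

Import Order.TTheory GRing.Theory Num.Theory.
Local Open Scope ring_scope.
Local Open Scope complex_scope.

(** Both invariants can be read off the Fourier coefficients, and zero-padding
    only adds coefficients equal to zero. On one grid line with [n] nodes,
    the mean value is the coefficient of the mode 0 ([fourier_coef0]), a mode
    that every even grid resolves, and the mean square is the sum of the squared
    moduli of the coefficients of the [n] resolved modes ([parseval]). Modes
    added with a zero coefficient change neither quantity, so the means of the
    line and of its refinement agree ([mean_zero_padding],
    [mean_sqr_zero_padding]).

    Mass and squared norm are [Lx * (2 * vmax)] times the double mean, over space
    and over velocity, of the array and of its squared modulus: the mesh sizes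
    are exactly the normalisations that turn sums over a line into means. Hence
    refining the lines of either direction one by one changes neither. *)

(** * Parseval on one grid line *)

(** For even [n], this enumerates the resolved modes as [i] runs through
    [0, ..., n - 1]. *)
Definition mode (n i : nat) : int := i%:Z - (n./2)%:Z.

Lemma resolved_mode (n i : nat) :
  ~~ odd n -> resolved n (mode n i) = (i < n)%N.
Proof. rewrite /resolved /mode => n_even; lia. Qed.

Lemma resolved0 (n : nat) : (0 < n)%N -> ~~ odd n -> resolved n 0.
Proof. rewrite /resolved; lia. Qed.

Lemma conj_expi (R : realType) (t : R) : Num.conj (expi t) = expi (- t).
Proof. by rewrite /expi cosN sinN. Qed.

(** Up to the factor [L / n], modes and nodes play symmetric roles in the phase:
    a sum over the modes is a sum over the nodes of a grid with origin
    [- (n./2) * (L / n)], with wavenumber index [j' - j]. The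
    orthogonality of the characters over the nodes then gives their
    orthogonality over the modes. *)
Lemma sum_expi_modes (R : realType) (a L : R) (n : nat) (j j' : 'I_n) :
    L != 0 ->
  \sum_(i < n) expi (wavenumber L (mode n i) *
      (grid_point a L n j' - grid_point a L n j))
    = if j == j' then n%:R else 0.
Proof.
move=> L0; have n0 : (0 < n)%N by case: n j {j'} => [[]|].
have n0R : n%:R != 0 :> R by rewrite pnatr_eq0 -lt0n.
pose d : int := (j' : nat)%:Z - (j : nat)%:Z.
transitivity (\sum_(i < n) expi (wavenumber L d *
    grid_point (- (n./2)%:R * (L / n%:R)) L n i)).
  apply: eq_bigr => i _; congr expi.
  rewrite /wavenumber /grid_point /mode /d !intrB -!pmulrn.
  by field; rewrite n0R.
rewrite sum_expi //; last by rewrite /d; have := ltn_ord j; have := ltn_ord j'; lia.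
by rewrite /d subr_eq0 eqz_nat eq_sym.
Qed.

(** Expanding each squared modulus as a double sum over nodes [j], [j'] and
    summing over the modes first leaves, by orthogonality, only the diagonal
    [j = j'], with weight [n]. *)
Lemma parseval (R : realType) (a L : R) (n : nat) (u : 'I_n -> R[i]) :
    L != 0 -> (0 < n)%N ->
  \sum_(i < n) `|fourier_coef a L u (mode n i)| ^+ 2
    = n%:R^-1 * \sum_(j < n) `|u j| ^+ 2.
Proof.
move=> L0 n0; have n0C : n%:R != 0 :> R[i] by rewrite pnatr_eq0 -lt0n.
have normE (i : 'I_n) : `|fourier_coef a L u (mode n i)| ^+ 2 =
    n%:R^-1 ^+ 2 * \sum_(j < n) \sum_(j' < n) u j * Num.conj (u j') *
      expi (wavenumber L (mode n i) *
        (grid_point a L n j' - grid_point a L n j)).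
  rewrite normCK /fourier_coef rmorphM fmorphV rmorph_nat rmorph_sum.
  rewrite mulrACA -expr2 mulr_suml; congr (_ * _); apply: eq_bigr => j _.
  rewrite mulr_sumr; apply: eq_bigr => j' _.
  rewrite rmorphM mulrACA; congr (_ * _).
  by rewrite [X in _ * X]conj_expi opprK -expiD addrC mulrBr.
under eq_bigr do rewrite normE.
rewrite -mulr_sumr exchange_big /= expr2 -mulrA; congr (_ * _).
rewrite mulr_sumr; apply: eq_bigr => j _; rewrite exchange_big /=.
under eq_bigr do rewrite -mulr_sumr sum_expi_modes //.
rewrite (bigD1 j) //= eqxx big1 ?addr0; last first.
  by move=> j' /negbTE; rewrite eq_sym => ->; rewrite mulr0.
by rewrite normCK mulrC mulfK.
Qed.

Lemma fourier_coef0 (R : realType) (a L : R) (n : nat) (u : 'I_n -> R[i]) :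
  fourier_coef a L u 0 = n%:R^-1 * \sum_(j < n) u j.
Proof.
rewrite /fourier_coef; congr (_ * _); apply: eq_bigr => j _.
by rewrite /wavenumber mulr0 !mul0r oppr0 expi0 mulr1.
Qed.

(** * Zero-padding of one grid line *)

(** The resolved modes of the coarse grid are a contiguous block in the middle
    of those of the fine grid. *)
Lemma sum_modes_widen (V : nmodType) (N M : nat) (F : int -> V) :
    ~~ odd N -> ~~ odd M -> (N <= M)%N ->
  \sum_(i < M) (if resolved N (mode M i) then F (mode M i) else 0)
    = \sum_(i < N) F (mode N i).
Proof.
move=> Neven Meven leNM; pose d := (M./2 - N./2)%N.
have dNM : (d + N <= M)%N by rewrite /d; lia.
pose G i := if resolved N (mode M i) then F (mode M i) else 0.
rewrite -(big_mkord xpredT G) (big_cat_nat (n := d)) //=; last by lia.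
rewrite (big_cat_nat (m := d) (n := d + N)%N) ?leq_addr //=.
have out i : ((i < d) || (d + N <= i))%N -> G i = 0.
  by rewrite /G /resolved /mode /d; case: ifP => //; lia.
rewrite big_nat big1 ?add0r; last by move=> i /andP[_ id]; rewrite out ?id.
rewrite [X in _ + X]big_nat [X in _ + X]big1 ?addr0; last first.
  by move=> i /andP[id _]; rewrite out ?id ?orbT.
rewrite -{1}[d]add0n [(d + N)%N]addnC big_addn addnK big_mkord; apply: eq_bigr => i _.
rewrite /G; have -> : mode M (i + d) = mode N i by rewrite /mode /d; lia.
by rewrite resolved_mode // ltn_ord.
Qed.

Section LinePadding.
Variables (R : realType) (a L : R) (N M : nat).
Variables (u : 'I_N -> R[i]) (w : 'I_M -> R[i]).
Hypotheses (L_neq0 : L != 0) (N_gt0 : (0 < N)%N) (N_even : ~~ odd N).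
Hypotheses (M_even : ~~ odd M) (leNM : (N <= M)%N).
Hypothesis w_pads_u : forall k, resolved M k ->
  fourier_coef a L w k = if resolved N k then fourier_coef a L u k else 0.

Lemma mean_zero_padding :
  M%:R^-1 * \sum_(j < M) w j = N%:R^-1 * \sum_(j < N) u j.
Proof.
have M_gt0 : (0 < M)%N := leq_trans N_gt0 leNM.
by rewrite -!(fourier_coef0 a L) w_pads_u !resolved0.
Qed.

Lemma mean_sqr_zero_padding :
  M%:R^-1 * \sum_(j < M) ComplexField.Normc.normc (w j) ^+ 2
    = N%:R^-1 * \sum_(j < N) ComplexField.Normc.normc (u j) ^+ 2.
Proof.
(* The real embedding turns [normc] into the norm of [R[i]]. *)
apply: (fmorph_inj (real_complex R)).
rewrite !rmorphM !fmorphV !rmorph_nat !rmorph_sum /=.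
under eq_bigr do rewrite rmorphXn.
under [in RHS]eq_bigr do rewrite rmorphXn.
rewrite -!(parseval a _ L_neq0) //; last exact: leq_trans leNM.
rewrite -(sum_modes_widen (fun k => `|fourier_coef a L u k| ^+ 2) N_even M_even)
  //.
apply: eq_bigr => i _; rewrite w_pads_u ?resolved_mode //.
by case: ifP => // _; rewrite normr0 expr0n.
Qed.

End LinePadding.

(** * Mass and norm as double means *)

Lemma mass_double_mean (R : realType) (Lx vmax : R) (p q : nat)
    (g : 'M[R[i]]_(p, q)) :
  mass Lx vmax g = (Lx * (2 * vmax))%:C *
    (p%:R^-1 * \sum_(l < p) (q%:R^-1 * \sum_(m < q) g l m)).
Proof.
rewrite /mass /cell_area -mulr_sumr !mulrA; congr (_ * _).
by rewrite !rmorphM !fmorphV !rmorph_nat; ring.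
Qed.

Lemma l2norm_double_mean (R : realType) (Lx vmax : R) (p q : nat)
    (g : 'M[R[i]]_(p, q)) :
  l2norm Lx vmax g = Num.sqrt (Lx * (2 * vmax) *
    (p%:R^-1 * \sum_(l < p)
      (q%:R^-1 * \sum_(m < q) ComplexField.Normc.normc (g l m) ^+ 2))).
Proof.
rewrite /l2norm /cell_area -mulr_sumr !mulrA; congr (Num.sqrt (_ * _)).
by ring.
Qed.

Lemma double_meanC (F : fieldType) (p q : nat) (g : 'I_p -> 'I_q -> F) :
  p%:R^-1 * \sum_(l < p) (q%:R^-1 * \sum_(m < q) g l m)
    = q%:R^-1 * \sum_(m < q) (p%:R^-1 * \sum_(l < p) g l m).
Proof. by rewrite -!mulr_sumr mulrCA exchange_big. Qed.

Theorem proposition3p1 (R : realType) (Lx vmax : R) (Nx Nv : nat)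
    (f : 'M[R]_(Nx, Nv)) :
  0 < Lx -> 0 < vmax ->
  (0 < Nx)%N -> ~~ odd Nx -> (0 < Nv)%N -> ~~ odd Nv ->
  (forall (Mv : nat) (fext : 'M[R[i]]_(Nx, Mv)),
      ~~ odd Mv -> (Nv < Mv)%N ->
      zero_padding_v vmax (map_mx (real_complex R) f) fext ->
      mass Lx vmax fext = mass Lx vmax (map_mx (real_complex R) f) /\
      l2norm Lx vmax fext = l2norm Lx vmax (map_mx (real_complex R) f)) /\
  (forall (Mx : nat) (fext : 'M[R[i]]_(Mx, Nv)),
      ~~ odd Mx -> (Nx < Mx)%N ->
      zero_padding_x Lx (map_mx (real_complex R) f) fext ->
      mass Lx vmax fext = mass Lx vmax (map_mx (real_complex R) f) /\
      l2norm Lx vmax fext = l2norm Lx vmax (map_mx (real_complex R) f)).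
Proof.
move=> Lx_gt0 vmax_gt0 Nx_gt0 Nx_even Nv_gt0 Nv_even.
have Lx_neq0 : Lx != 0 by rewrite gt_eqF.
have Lv_neq0 : 2 * vmax != 0 by rewrite mulf_neq0 // gt_eqF.
split=> [Mv|Mx] fext M_even /ltnW leNM pad.
  rewrite !mass_double_mean !l2norm_double_mean.
  split; [congr (_ * (_ * _)) | congr (Num.sqrt (_ * (_ * _)))];
    apply: eq_bigr => l _.
    exact: (mean_zero_padding Nv_gt0 Nv_even M_even leNM (pad l)).
  exact: (mean_sqr_zero_padding Lv_neq0 Nv_gt0 Nv_even M_even leNM (pad l)).
rewrite !mass_double_mean !l2norm_double_mean.
split; rewrite double_meanC [in RHS]double_meanC;
  [congr (_ * (_ * _)) | congr (Num.sqrt (_ * (_ * _)))];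
  apply: eq_bigr => m _.
  exact: (mean_zero_padding Nx_gt0 Nx_even M_even leNM (fun k => @pad k m)).
exact: (mean_sqr_zero_padding Lx_neq0 Nx_gt0 Nx_even M_even leNM
  (fun k => @pad k m)).
Qed.
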